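(* Let $V=\mathrm{Fun}\,M$ be the ring of regular functions on $M=\{(a,b,c)\in\mathbb C^3:c\ne0,\ c\ne ab\}$, let $V_+\subset V$ be the subspace of all regular functions on $M_+=\mathbb C^3\setminus\{c=0\}$, and let $\langle f,g\rangle=\mathrm{Res}(f\cdot g)$ be the bilinear form on $V$ defined in the context. Then: (i) $V_+$ contains the unit function $1$ and is closed under multiplication; (ii) $V_+$ is invariant under the action of $\mathfrak n_+$, i.e. under the derivations $\partial_1=\frac{\partial}{\partial a}$, $\partial_2=\frac{\partial}{\partial b}+a\frac{\partial}{\partial c}$, $\partial_3=\frac{\partial}{\partial c}$; (iii) the bilinear form $\langle\cdot,\cdot\rangle$ is non-degenerate on $V$; (iv) $V_+$ is a maximal isotropic subspace of $V$ with respect to $\langle\cdot,\cdot\rangle$.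
   Context: The functions $e_{nml}=a^nc^m(c-ab)^l$ ($n\ge0$, $m,l\in\mathbb Z$) and $f_{nml}=b^nc^m(c-ab)^l$ ($n>0$, $m,l\in\mathbb Z$) form a basis of $V=\mathbb C[a,b,c,c^{-1},(c-ab)^{-1}]$. For $f\in V$, $\mathrm{Res}\,f\in\mathbb C$ is the coefficient of $\phi=e_{0,-1,-1}=\frac{1}{c(c-ab)}$ in the decomposition of $f$ in this basis. $V_+$ is the span of the $e_{nml}$ with $n,l\ge0$, $m\in\mathbb Z$ and the $f_{nml}$ with $n>0$, $l\ge0$, $m\in\mathbb Z$; i.e. $V_+=\mathbb C[a,b,c,c^{-1}]$. $\mathfrak n_+$ is the Lie algebra of strictly upper triangular $3\times3$ matrices, acting on $V$ through $E_{12}\mapsto\partial_1$, $E_{23}\mapsto\partial_2$, $E_{13}\mapsto\partial_3$. *)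

(* Defs.v *)
From HB Require Import structures.
From mathcomp Require Import all_boot all_order all_algebra.
From mathcomp Require Import fraction generic_quotient finmap mpoly complex.
From mathcomp Require Import boolp classical_sets reals ring.

Set Implicit Arguments.
Unset Strict Implicit.
Unset Printing Implicit Defensive.

Import GRing.Theory.
Local Open Scope ring_scope.
Local Open Scope classical_set_scope.
Local Open Scope quotient_scope.

Section Fractions.
Variable R : idomainType.
Implicit Types p q n d : R.

Lemma frac_repr (f : {fraction R}) :
  f = tofrac \n_(repr f) / tofrac \d_(repr f).
Proof.
have d0 := denom_ratioP (repr f).
have td0 : tofrac \d_(repr f) != 0 by rewrite tofrac_eq0.
apply: (mulIf td0); rewrite mulfVK //.
rewrite -[X in X * _ = _]reprK !piE; apply/eqP.
rewrite FracField.equivf_def /FracField.mulf /= !numden_Ratio ?oner_neq0 //.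
- by rewrite !mulr1 mulrC.
- by rewrite mulr1.
- by rewrite mulr1.
Qed.

Lemma eq_frac p q n d : q != 0 -> d != 0 ->
  tofrac p / tofrac q = tofrac n / tofrac d <-> p * d = n * q.
Proof.
move=> q0 d0; rewrite (rwP eqP) eqr_div ?tofrac_eq0 //.
by rewrite -!tofracM tofrac_eq; split=> /eqP.
Qed.

Lemma eq_fracX2 p q n d : q != 0 -> d != 0 -> p * d ^+ 2 = n * q ^+ 2 ->
  tofrac p / tofrac q ^+ 2 = tofrac n / tofrac d ^+ 2.
Proof.
by move=> q0 d0 e; rewrite -!tofracXn; apply/eq_frac; rewrite ?expf_neq0.
Qed.

End Fractions.

(* All rings of regular functions below are subrings of the field F(a, b, c)   *)
(* of rational functions on affine 3-space.                                   *)
Section RegularFunctions.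
Variable F : fieldType.

Definition ratfun := {fraction {mpoly F[3]}}.

Definition cst (z : F) : ratfun := tofrac z%:MP.

Definition ia : 'I_3 := @Ordinal 3 0 isT.
Definition ib : 'I_3 := @Ordinal 3 1 isT.
Definition ic : 'I_3 := @Ordinal 3 2 isT.

Definition va : ratfun := tofrac 'X_ia.
Definition vb : ratfun := tofrac 'X_ib.
Definition vc : ratfun := tofrac 'X_ic.

(* The F-subalgebra F[g_0, ..., g_(n-1)] of F(a, b, c): all values            *)
(* P(g_0, ..., g_(n-1)) of polynomials P in n variables.                      *)
Definition gen_alg (n : nat) (g : n.-tuple ratfun) : set ratfun :=
  [set f | exists P : {mpoly F[n]}, f = mmap cst (tnth g) P].

(* Fun M = F[a, b, c, 1/c, 1/(c - ab)], the coordinate ring of the affine     *)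
(* variety M = {c <> 0, c <> ab}.                                             *)
Definition V : set ratfun :=
  gen_alg [tuple va; vb; vc; vc^-1; (vc - va * vb)^-1].

(* Fun M_+ = F[a, b, c, 1/c], the coordinate ring of M_+ = {c <> 0}.          *)
Definition Vplus : set ratfun := gen_alg [tuple va; vb; vc; vc^-1].

Definition basis_e (n : nat) (m l : int) : ratfun :=
  va ^+ n * vc ^ m * (vc - va * vb) ^ l.
Definition basis_f (n : nat) (m l : int) : ratfun :=
  vb ^+ n * vc ^ m * (vc - va * vb) ^ l.

(* inl (n, m, l) indexes e_{n,m,l}, and inr (n, m, l) indexes f_{n+1,m,l}:    *)
(* the family f only starts at exponent 1.                                    *)
Definition basis_idx := ((nat * int * int) + (nat * int * int))%type.

Definition basis_vec (k : basis_idx) : ratfun :=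
  match k with
  | inl (n, m, l) => basis_e n m l
  | inr (n, m, l) => basis_f n.+1 m l
  end.

Definition phi_idx : basis_idx := inl (0%N, -1, -1).

Definition decomposition (d : {fsfun basis_idx -> F with 0}) (f : ratfun) :=
  f = \sum_(k <- finsupp d) cst (d k) * basis_vec k.

(* As the vectors basis_vec k form a basis of V, every f in V has exactly one *)
(* decomposition, so that the set below is a singleton.  The default value 0  *)
(* of xget is only used for f outside V.                                      *)
Definition Res (f : ratfun) : F :=
  xget 0 [set r | exists2 d, decomposition d f & r = d phi_idx].

Definition pairing (f g : ratfun) : F := Res (f * g).

(* Formal partial derivatives of rational functions, by the quotient rule     *)
(* applied to a representative; see pderE for the independence of the choice. *)
Definition pder (i : 'I_3) (f : ratfun) : ratfun :=
  let r := repr f in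
  tofrac (mderiv i \n_r * \d_r - \n_r * mderiv i \d_r) / tofrac \d_r ^+ 2.

Lemma pderE (i : 'I_3) (p q : {mpoly F[3]}) : q != 0 ->
  pder i (tofrac p / tofrac q) =
  tofrac (mderiv i p * q - p * mderiv i q) / tofrac q ^+ 2.
Proof.
move=> q0; rewrite /pder.
have := frac_repr (tofrac p / tofrac q).
move: (repr (tofrac p / tofrac q)) => r.
have := denom_ratioP r; move: (\n_r) (\d_r) => n d d0 fE.
have {fE} pdE : p * d = n * q by exact: (@eq_frac _ p q n d q0 d0).1 fE.
have := congr1 (mderiv i) pdE; rewrite !mderivM => dE.
apply: eq_fracX2 => //.
transitivity (d * q * (mderiv i n * q + n * mderiv i q)
              - n * q * (mderiv i d * q + d * mderiv i q)).
  by ring.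
by rewrite -dE -pdE; ring.
Qed.

Definition d1 (f : ratfun) : ratfun := pder ia f.
Definition d2 (f : ratfun) : ratfun := pder ib f + va * pder ic f.
Definition d3 (f : ratfun) : ratfun := pder ic f.

Definition nplus : set 'M[F]_3 :=
  [set X | forall i j : 'I_3, (j <= i)%N -> X i j = 0].

(* E_12 acts as d1, E_23 as d2 and E_13 as d3; indices start at 0 here.       *)
Definition nplus_act (X : 'M[F]_3) (f : ratfun) : ratfun :=
  cst (X ia ib) * d1 f + cst (X ib ic) * d2 f + cst (X ia ic) * d3 f.

Definition is_subspace (W : set ratfun) :=
  W 0 /\ forall (z : F) (f g : ratfun), W f -> W g -> W (cst z * f + g).

Definition nondegenerate_on (B : ratfun -> ratfun -> F) (U : set ratfun) :=
  (forall f, U f -> (forall g, U g -> B f g = 0) -> f = 0) /\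
  (forall g, U g -> (forall f, U f -> B f g = 0) -> g = 0).

Definition isotropic_subspace (B : ratfun -> ratfun -> F)
    (U W : set ratfun) :=
  [/\ W `<=` U, is_subspace W & forall f g, W f -> W g -> B f g = 0].

Definition maximal_isotropic (B : ratfun -> ratfun -> F)
    (U W : set ratfun) :=
  isotropic_subspace B U W /\
  forall W', isotropic_subspace B U W' -> W `<=` W' -> W' = W.

End RegularFunctions.

Arguments V : clear implicits.
Arguments Vplus : clear implicits.
Arguments nplus : clear implicits.

(* Main.v *)
Require Import Defs.
From HB Require Import structures.
From mathcomp Require Import all_boot all_order all_algebra.
From mathcomp Require Import fraction finmap mpoly complex.
From mathcomp Require Import boolp classical_sets reals.
From mathcomp Require Import zify.

Set Implicit Arguments.
Unset Strict Implicit.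
Unset Printing Implicit Defensive.

Import Order.TTheory GRing.Theory Num.Theory.
Local Open Scope ring_scope.
Local Open Scope classical_set_scope.

(** Write t = c - ab, so that ab = c - t.  Since b = (c - t) / a, the ring V
    embeds in the Laurent polynomials in a, c, t; symmetrically it embeds in
    those in b, c, t.  The three coordinates are algebraically independent
    ([coord_inj]), so Laurent coefficients make sense.  In these coordinates
    e_{nml} is the monomial a^n c^m t^l and f_{nml} is
    a^{-n} (c - t)^n c^m t^l, which has degree -n in a.  Hence the coefficient
    of e_{nml} in a decomposition is a Laurent coefficient in the coordinates
    (a, c, t), and the coefficient of f_{nml} is one in the coordinates
    (b, c, t) ([coefL_decomposition]).  In particular Res f is the coefficient
    of (ct)^{-1}, in either system ([Res_coefL]).

    The form is then explicit: with x one of a, b and y the other, pairing f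
    with y^n c^m t^l reads off one coefficient of x^n in (c - t)^n f.  The
    heart of the proof is [vctX_cancel]: if all coefficients of
    (c - t)^n f at x^i c^j t^l with l < N vanish, then so do those of f.  For
    n = 1 the hypothesis says that the coefficients of f are constant along the
    antidiagonals j + l = const with l < N, and only finitely many are non-zero.
    So a function of V orthogonal to all basis vectors with l >= N has no
    component along those with l < -N ([orthogonal_coefL]).  With N arbitrary this gives
    non-degeneracy; with N = 0 it shows that the orthogonal of V_+ is contained
    in V_+, which is maximality once V_+ is isotropic.  Isotropy holds because
    V_+ is a ring in which no negative power of t occurs
    ([Vplus_t_integral]).

    Stability under the derivations is the quotient rule: V_+ consists of the
    fractions p / c^n ([Vplus_fracP]). *)

Section RegularFunctionsTheory.
Variable F : fieldType.
Implicit Types (f g h : ratfun F) (z : F) (s : bool) (i j l m : int).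

HB.instance Definition _ :=
  GRing.RMorphism.copy (@cst F) (@tofrac {mpoly F[3]} \o @mpolyC 3 F).

Lemma bool_neqE s s' : s' != s -> s' = ~~ s.
Proof. by case: s; case: s'. Qed.

Lemma mpoly_rmorph_ext (n : nat) (A : comNzRingType)
    (u v : {rmorphism {mpoly F[n]} -> A}) :
  (forall z, u z%:MP = v z%:MP) -> (forall k, u 'X_k = v 'X_k) -> u =1 v.
Proof.
move=> uvC uvX p; rewrite [p]mpolyE !rmorph_sum; apply: eq_bigr => m _.
rewrite -mul_mpolyC !rmorphM uvC; congr (_ * _).
rewrite mpolyXE_id !rmorph_prod; apply: eq_bigr => k _.
by rewrite !rmorphXn /= uvX.
Qed.

(** * Finitely generated algebras *)

Section GeneratedAlgebra.
Variables (n : nat) (gens : n.-tuple (ratfun F)).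

Lemma gen_alg_cst z : gen_alg gens (cst z).
Proof. by exists z%:MP; rewrite mmapC. Qed.

Lemma gen_alg_gen k : gen_alg gens (tnth gens k).
Proof. by exists 'X_k; rewrite mmapX mmap1U. Qed.

Lemma gen_algD f g : gen_alg gens f -> gen_alg gens g -> gen_alg gens (f + g).
Proof. by move=> [P ->] [Q ->]; exists (P + Q); rewrite mmapD. Qed.

Lemma gen_algM f g : gen_alg gens f -> gen_alg gens g -> gen_alg gens (f * g).
Proof. by move=> [P ->] [Q ->]; exists (P * Q); rewrite [RHS]rmorphM. Qed.

Lemma gen_algX k f : gen_alg gens f -> gen_alg gens (f ^+ k).
Proof.
move=> Gf; elim: k => [|k IH]; last by rewrite exprS; apply: gen_algM.
by have := gen_alg_cst 1; rewrite rmorph1.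
Qed.

Lemma gen_algXz k f :
  gen_alg gens f -> gen_alg gens f^-1 -> gen_alg gens (f ^ k).
Proof.
move=> Gf GfV; case: k => k; first exact: gen_algX.
by rewrite NegzE -exprz_inv; apply: gen_algX.
Qed.

Lemma gen_algB f g : gen_alg gens f -> gen_alg gens g -> gen_alg gens (f - g).
Proof.
move=> Gf Gg; apply: gen_algD => //.
rewrite -mulN1r -(rmorphN1 (@cst F)).
by apply: gen_algM => //; exact: gen_alg_cst.
Qed.

Lemma gen_alg_sum (I : Type) (r : seq I) (G : I -> ratfun F) :
  (forall k, gen_alg gens (G k)) -> gen_alg gens (\sum_(k <- r) G k).
Proof.
move=> GG; elim/big_rec: _ => [|k f _ Gf]; last exact: gen_algD.
by have := gen_alg_cst 0; rewrite rmorph0.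
Qed.

Lemma gen_alg_ind (K : ratfun F -> Prop) :
  (forall z, K (cst z)) -> (forall f g, K f -> K g -> K (f + g)) ->
  (forall f g, K f -> K g -> K (f * g)) -> (forall k, K (tnth gens k)) ->
  forall f, gen_alg gens f -> K f.
Proof.
move=> KC KD KM Kg f [P ->]; rewrite /mmap.
have K0 : K 0 by rewrite -(rmorph0 (@cst F)); apply: KC.
have K1 : K 1 by rewrite -(rmorph1 (@cst F)); apply: KC.
elim/big_rec: _ => // m g _ Kg'; apply: (KD) => //; apply: (KM) => //.
rewrite /mmap1; elim/big_rec: _ => // k h _ Kh; apply: (KM) => //.
by elim: (m k) => [|d IH]; rewrite ?expr0 // exprS; apply: (KM).
Qed.

End GeneratedAlgebra.

(** * The rings V and V_+ *)

Definition vt : ratfun F := vc F - va F * vb F.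
(** A boolean selects a or b, so that every statement about a also covers its
    mirror image under exchanging a and b; [~~ s] is the other variable. *)
Definition vx s : ratfun F := if s then va F else vb F.

Lemma Vplus_cst z : Vplus F (cst z). Proof. exact: gen_alg_cst. Qed.

Lemma Vplus_vx s : Vplus F (vx s).
Proof.
by case: s; [exact: (gen_alg_gen _ (@Ordinal 4 0 isT))
            |exact: (gen_alg_gen _ (@Ordinal 4 1 isT))].
Qed.

Lemma Vplus_vc : Vplus F (vc F).
Proof. exact: (gen_alg_gen _ (@Ordinal 4 2 isT)). Qed.

Lemma Vplus_vcV : Vplus F (vc F)^-1.
Proof. exact: (gen_alg_gen _ (@Ordinal 4 3 isT)). Qed.

Lemma Vplus_vt : Vplus F vt.
Proof.
apply: gen_algB; first exact: Vplus_vc.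
by apply: gen_algM; [exact: (Vplus_vx true)|exact: (Vplus_vx false)].
Qed.

Lemma V_vx s : V F (vx s).
Proof.
by case: s; [exact: (gen_alg_gen _ (@Ordinal 5 0 isT))
            |exact: (gen_alg_gen _ (@Ordinal 5 1 isT))].
Qed.

Lemma V_vc : V F (vc F).
Proof. exact: (gen_alg_gen _ (@Ordinal 5 2 isT)). Qed.

Lemma V_vcV : V F (vc F)^-1.
Proof. exact: (gen_alg_gen _ (@Ordinal 5 3 isT)). Qed.

Lemma V_vtV : V F vt^-1.
Proof. exact: (gen_alg_gen _ (@Ordinal 5 4 isT)). Qed.

Lemma Vplus_ind (K : ratfun F -> Prop) :
  (forall z, K (cst z)) -> (forall f g, K f -> K g -> K (f + g)) ->
  (forall f g, K f -> K g -> K (f * g)) ->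
  (forall s, K (vx s)) -> K (vc F) -> K (vc F)^-1 ->
  forall f, Vplus F f -> K f.
Proof.
move=> KC KD KM Kx Kc KcV; apply: gen_alg_ind => // -[[|[|[|[|]]]]] // lt4.
all: rewrite (tnth_nth 0) //=.
- exact: (Kx true).
- exact: (Kx false).
Qed.

Lemma V_ind (K : ratfun F -> Prop) :
  (forall z, K (cst z)) -> (forall f g, K f -> K g -> K (f + g)) ->
  (forall f g, K f -> K g -> K (f * g)) ->
  (forall s, K (vx s)) -> K (vc F) -> K (vc F)^-1 -> K vt^-1 ->
  forall f, V F f -> K f.
Proof.
move=> KC KD KM Kx Kc KcV KtV.
apply: gen_alg_ind => // -[[|[|[|[|[|]]]]]] // lt5.
all: rewrite (tnth_nth 0) //=.
- exact: (Kx true).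
- exact: (Kx false).
Qed.

Lemma Vplus_sub_V : Vplus F `<=` V F.
Proof.
apply: Vplus_ind; [exact: gen_alg_cst | exact: gen_algD | exact: gen_algM
  | exact: V_vx | exact: V_vc | exact: V_vcV].
Qed.

(** * Stability under the derivations *)

Lemma Vplus_tofrac (p : {mpoly F[3]}) : Vplus F (tofrac p).
Proof.
elim/mpolyind: p => [|z m p _ _ Vp].
  by rewrite tofrac0 -(rmorph0 (@cst F)); apply: Vplus_cst.
rewrite tofracD; apply: gen_algD => //.
rewrite -mul_mpolyC tofracM; apply: gen_algM; first exact: Vplus_cst.
rewrite mpolyXE_id rmorph_prod; elim/big_rec: _ => [|k f _ Vf].
  by rewrite -(rmorph1 (@cst F)); apply: Vplus_cst.
apply: gen_algM => //; rewrite rmorphXn; apply: gen_algX.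
case: k => [[|[|[|]]]] // lt3.
- rewrite (_ : Ordinal lt3 = ia); [exact: (Vplus_vx true) | exact: val_inj].
- rewrite (_ : Ordinal lt3 = ib); [exact: (Vplus_vx false) | exact: val_inj].
- rewrite (_ : Ordinal lt3 = ic); [exact: (Vplus_vc) | exact: val_inj].
Qed.

Lemma mpolyXU_neq0 (k : 'I_3) : 'X_k != 0 :> {mpoly F[3]}.
Proof.
apply/eqP => /(congr1 (mcoeff U_(k))); rewrite mcoeffXU eqxx mcoeff0.
by move/eqP; rewrite oner_eq0.
Qed.

Lemma vc_neq0 : vc F != 0. Proof. by rewrite tofrac_eq0 mpolyXU_neq0. Qed.

(** This form is what the quotient rule [pderE] applies to. *)
Lemma Vplus_fracP f :
  Vplus F f <-> exists p n, f = tofrac p / tofrac ('X_(ic) ^+ n).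
Proof.
split; last first.
  move=> [p [n ->]]; apply: gen_algM; first exact: Vplus_tofrac.
  by rewrite tofracXn -exprVn; apply: gen_algX; apply: Vplus_vcV.
have poly (p : {mpoly F[3]}) :
    exists q n, tofrac p = tofrac q / tofrac ('X_(ic) ^+ n).
  by exists p, 0%N; rewrite expr0 tofrac1 divr1.
elim/Vplus_ind: f /
  => [z|f g [p [n ->]] [q [m ->]]|f g [p [n ->]] [q [m ->]]|s||].
- exact: poly.
- exists (p * 'X_(ic) ^+ m + q * 'X_(ic) ^+ n), (n + m)%N.
  rewrite exprD tofracD !tofracM.
  by rewrite addf_div ?tofrac_eq0 ?expf_neq0 ?mpolyXU_neq0 //.
- by exists (p * q), (n + m)%N; rewrite exprD !tofracM mulf_div.
- by case: s; apply: poly.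
- exact: poly.
- by exists 1, 1%N; rewrite tofrac1 div1r expr1.
Qed.

Lemma Vplus_pder k f : Vplus F f -> Vplus F (pder k f).
Proof.
move=> /Vplus_fracP [p [n ->]]; rewrite pderE ?expf_neq0 ?mpolyXU_neq0 //.
by apply/Vplus_fracP; eexists _, (n * 2)%N; rewrite exprM [in RHS]tofracXn.
Qed.

Lemma Vplus_derivations f : Vplus F f ->
  [/\ Vplus F (d1 f), Vplus F (d2 f) & Vplus F (d3 f)].
Proof.
move=> Vf; split; [exact: Vplus_pder | | exact: Vplus_pder].
apply: gen_algD; first exact: Vplus_pder.
by apply: gen_algM; [exact: (Vplus_vx true) | exact: Vplus_pder].
Qed.

(** * Algebraic independence of the coordinates (a, c, t) and (b, c, t) *)

Lemma vx_mul s : vx s * vx (~~ s) = vc F - vt.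
Proof. by rewrite /vt; case: s; rewrite /= opprB addrC subrK // mulrC. Qed.

Definition axis s : 'I_3 := if s then ia else ib.

Definition coord_tuple s : 3.-tuple {mpoly F[3]} :=
  [tuple 'X_(axis s); 'X_(ic); 'X_(ic) - 'X_(ia) * 'X_(ib)].

(** The images of a, b, c under the substitution inverse to [coord_tuple s],
    where the letters a, b, c stand for the three coordinates x, c, t: the
    variable left out of the coordinates becomes (c - t) / x. *)
Definition coord_inv s (k : 'I_3) : ratfun F :=
  if k == ic then vb F
  else if k == axis s then va F else (vb F - vc F) / va F.

(** Algebraic independence: expressing a, b, c rationally through the
    coordinates yields a left inverse of the substitution. *)
Lemma coord_inj s : injective (comp_mpoly (coord_tuple s)).
Proof.
pose sigma := mmap (@cst F) (coord_inv s).
suff sK (p : {mpoly F[3]}) : sigma (p \mPo coord_tuple s) = tofrac p.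
  by move=> p q /(congr1 sigma); rewrite !sK => /eqP; rewrite tofrac_eq => /eqP.
have sX k : sigma 'X_k = coord_inv s k by rewrite /sigma mmapX mmap1U.
pose u : {rmorphism {mpoly F[3]} -> ratfun F} :=
  GRing.RMorphism.clone _ _ (sigma \o comp_mpoly (coord_tuple s)) _.
rewrite -[LHS]/(u p); apply: mpoly_rmorph_ext => [z|k] /=.
  by rewrite comp_mpolyC /sigma mmapC.
have a0 : va F != 0 by rewrite tofrac_eq0 mpolyXU_neq0.
rewrite comp_mpolyXU; case: k => [[|[|[|]]]] // lt3.
- rewrite (_ : Ordinal lt3 = ia); last exact: val_inj.
  by apply: etrans (sX (axis s)) _; rewrite /coord_inv eqxx; case: (s).
- rewrite (_ : Ordinal lt3 = ib); last exact: val_inj.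
  exact: etrans (sX ic) _.
- rewrite (_ : Ordinal lt3 = ic); last exact: val_inj.
  transitivity (sigma 'X_(ic) - sigma 'X_(ia) * sigma 'X_(ib)).
    by rewrite -[RHS]/(sigma _ - _) -rmorphM -rmorphB.
  rewrite !sX /coord_inv /axis /= -/(vc F).
  case: (s) => /=; rewrite 1?[_ * va F]mulrC mulrCA ?mulfV // mulr1 opprB.
  all: by rewrite addrCA subrr addr0.
Qed.

Lemma vx_neq0 s : vx s != 0.
Proof. by case: s; rewrite tofrac_eq0 mpolyXU_neq0. Qed.

Lemma vt_tofrac : vt = tofrac ('X_(ic) - 'X_(ia) * 'X_(ib)).
Proof. by rewrite tofracB tofracM. Qed.

Lemma vt_neq0 : vt != 0.
Proof.
rewrite vt_tofrac tofrac_eq0; apply: contra_neq (mpolyXU_neq0 ic) => t0.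
by apply: (@coord_inj true); rewrite comp_mpoly0 comp_mpolyXU.
Qed.

(** * Laurent expansions *)

(** Exponents of x, c and t, in this order. *)
Definition expo := (int * int * int)%type.
Implicit Types (e : expo) (xs : seq (F * expo)).

Definition mono s e : ratfun F := vx s ^ e.1.1 * vc F ^ e.1.2 * vt ^ e.2.

Lemma monoD s e e' : mono s (e + e') = mono s e * mono s e'.
Proof.
rewrite /mono !expfzDr ?vx_neq0 ?vc_neq0 ?vt_neq0 //=.
by rewrite [RHS]mulrACA; congr (_ * _); rewrite [RHS]mulrACA.
Qed.

Lemma mono0 s : mono s 0 = 1.
Proof. by rewrite /mono !expr0z !mulr1. Qed.

Lemma mono_neq0 s e : mono s e != 0.
Proof. by rewrite !mulf_neq0 ?expfz_neq0 ?vx_neq0 ?vc_neq0 ?vt_neq0. Qed.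

(** A Laurent polynomial is presented by a list of terms, with possibly
    repeated exponents: sums, scalings and shifts of presentations are then
    plain list operations, and [lcoef] collects the terms of an exponent. *)
Definition lsum s xs : ratfun F := \sum_(x <- xs) cst x.1 * mono s x.2.
Definition lcoef e xs : F := \sum_(x <- xs | x.2 == e) x.1.

Definition shift e xs : seq (F * expo) := [seq (x.1, e + x.2) | x <- xs].

Lemma lsum_shift s e xs : lsum s (shift e xs) = mono s e * lsum s xs.
Proof.
rewrite /lsum big_map mulr_sumr; apply: eq_bigr => x _ /=.
by rewrite monoD mulrCA.
Qed.

Lemma lcoef_shift e e' xs : lcoef e (shift e' xs) = lcoef (e - e') xs.
Proof.
rewrite /lcoef big_map; apply: eq_bigl => x /=.
by rewrite [RHS]eq_sym subr_eq addrC eq_sym.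
Qed.

Definition nonneg e := [&& 0 <= e.1.1, 0 <= e.1.2 & 0 <= e.2].

Lemma expo_bound (es : seq expo) :
  exists N : nat, forall e, e \in es -> nonneg (e + (N%:Z, N%:Z, N%:Z)).
Proof.
elim: es => [|[[i j] l] es [N IH]]; first by exists 0%N.
exists (N + `|i| + `|j| + `|l|)%N => e; rewrite inE => /predU1P[->|/IH].
  by rewrite /nonneg /=; lia.
by case: e => [[i' j'] l']; rewrite /nonneg /=; lia.
Qed.

(** Absolute values only serve to land in nat: see [mexpo_eq]. *)
Definition mexpo e : 'X_{1..3} :=
  [multinom [tuple `|e.1.1|%N; `|e.1.2|%N; `|e.2|%N]].

Lemma mexpo_eq e e' : nonneg e -> nonneg e' ->
  (mexpo e == mexpo e') = (e == e').
Proof.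
case: e e' => [[i j] l] [[i' j'] l'] /and3P[/= i0 j0 l0] /and3P[/= i0' j0' l0'].
apply/eqP/eqP => [/mnmP eqm|->//].
have := eqm ia; have := eqm ib; have := eqm ic.
rewrite !multinomE !(tnth_nth 0%N) /= => *.
by congr (_, _, _); lia.
Qed.

Lemma mono_tofrac s e : nonneg e ->
  mono s e = tofrac ('X_[mexpo e] \mPo coord_tuple s).
Proof.
case: e => [[i j] l] /and3P[/= i0 j0 l0].
rewrite comp_mpolyX rmorph_prod !big_ord_recl big_ord0 mulr1 mulrA /=.
rewrite !rmorphXn /= !multinomE !(tnth_nth 0%N) !(tnth_nth 0) /= -vt_tofrac.
rewrite /mono /= -[in LHS](gez0_abs i0) -[in LHS](gez0_abs j0).
rewrite -[in LHS](gez0_abs l0).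
by congr (_ ^+ _ * _ * _); case: (s).
Qed.

(** Multiplying by a large power of x c t makes all exponents non-negative, and
    reduces the claim to the independence of the coordinates. *)
Lemma lsum_eq0 s xs : lsum s xs = 0 -> forall e, lcoef e xs = 0.
Proof.
move=> xs0 e.
(* e may occur in no term, but its shift must be non-negative as well. *)
have [N Npos] := expo_bound (e :: [seq x.2 | x <- xs]).
have e_pos := Npos e (mem_head _ _).
pose c : expo := (N%:Z, N%:Z, N%:Z).
have pos x : x \in shift c xs -> nonneg x.2.
  case/mapP => y y_xs -> /=; rewrite addrC; apply: Npos.
  by rewrite inE map_f ?orbT.
have : lsum s (shift c xs) = 0 by rewrite lsum_shift xs0 mulr0.
rewrite -[e](addrK c) -lcoef_shift; move: (shift c xs) pos => {xs0 Npos}ys pos.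
pose p := \sum_(x <- ys) x.1 *: 'X_[mexpo x.2] : {mpoly F[3]}.
have -> : lsum s ys = tofrac (p \mPo coord_tuple s).
  rewrite /p (raddf_sum (comp_mpoly (coord_tuple s))) (raddf_sum (@tofrac _)).
  apply: eq_big_seq => x /pos x_pos /=.
  by rewrite mono_tofrac // -tofracM comp_mpolyZ mul_mpolyC.
move/eqP; rewrite tofrac_eq0 => /eqP p0.
have {p0} p0 : p = 0 by apply: (@coord_inj s); rewrite p0 comp_mpoly0.
have := congr1 (mcoeff (mexpo (e + c))) p0; rewrite mcoeff0 => <-.
rewrite /lcoef big_mkcond /= raddf_sum /=; apply: eq_big_seq => x /pos x_pos.
by rewrite mcoeffZ mcoeffX mexpo_eq //; case: eqP; rewrite ?mulr1 ?mulr0.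
Qed.

Lemma lsum_cat s xs ys : lsum s (xs ++ ys) = lsum s xs + lsum s ys.
Proof. exact: big_cat. Qed.

Lemma lcoef_cat e xs ys : lcoef e (xs ++ ys) = lcoef e xs + lcoef e ys.
Proof. exact: big_cat. Qed.

Definition lscale z xs : seq (F * expo) := [seq (z * x.1, x.2) | x <- xs].

Lemma lsum_scale s z xs : lsum s (lscale z xs) = cst z * lsum s xs.
Proof.
rewrite /lsum big_map mulr_sumr; apply: eq_bigr => x _ /=.
by rewrite rmorphM mulrA.
Qed.

Lemma lcoef_scale e z xs : lcoef e (lscale z xs) = z * lcoef e xs.
Proof. by rewrite /lcoef big_map mulr_sumr. Qed.

Definition laurent s f := exists xs, f = lsum s xs.

(** By [lsum_eq0] the value does not depend on the presentation; see
    [coefL_lsum].  The default 0 concerns only f that are not Laurent. *)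
Definition coefL s e f : F :=
  xget 0 [set r | exists2 xs, f = lsum s xs & r = lcoef e xs].

Lemma coefL_lsum s e xs : coefL s e (lsum s xs) = lcoef e xs.
Proof.
apply: xget_unique => [|_ [ys eq_xs ->]]; first by exists xs.
apply/eqP; rewrite -subr_eq0 -mulN1r -lcoef_scale -lcoef_cat.
apply/eqP/(@lsum_eq0 s).
by rewrite lsum_cat lsum_scale eq_xs rmorphN1 mulN1r subrr.
Qed.

Lemma laurentD s f g : laurent s f -> laurent s g -> laurent s (f + g).
Proof. by move=> [xs ->] [ys ->]; exists (xs ++ ys); rewrite lsum_cat. Qed.

Lemma laurentZ s z f : laurent s f -> laurent s (cst z * f).
Proof. by move=> [xs ->]; exists (lscale z xs); rewrite lsum_scale. Qed.

Lemma laurent_mulmono s e f : laurent s f -> laurent s (mono s e * f).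
Proof. by move=> [xs ->]; exists (shift e xs); rewrite lsum_shift. Qed.

Lemma coefLD s e f g : laurent s f -> laurent s g ->
  coefL s e (f + g) = coefL s e f + coefL s e g.
Proof.
by move=> [xs ->] [ys ->]; rewrite -lsum_cat !coefL_lsum lcoef_cat.
Qed.

Lemma coefLZ s e z f : laurent s f -> coefL s e (cst z * f) = z * coefL s e f.
Proof. by move=> [xs ->]; rewrite -lsum_scale !coefL_lsum lcoef_scale. Qed.

Lemma coefLB s e f g : laurent s f -> laurent s g ->
  coefL s e (f - g) = coefL s e f - coefL s e g.
Proof.
move=> Lf Lg; have N1 : - g = cst (-1) * g by rewrite rmorphN1 mulN1r.
by rewrite N1 coefLD ?coefLZ ?mulN1r //; apply: laurentZ.
Qed.

Lemma coefL_mono s e e' f : laurent s f ->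
  coefL s e (mono s e' * f) = coefL s (e - e') f.
Proof. by move=> [xs ->]; rewrite -lsum_shift !coefL_lsum lcoef_shift. Qed.

Lemma laurent0 s : laurent s 0.
Proof. by exists [::]; rewrite /lsum big_nil. Qed.

Lemma laurent1 s : laurent s 1.
Proof. by exists [:: (1, 0)]; rewrite /lsum big_seq1 rmorph1 mono0 mulr1. Qed.

Lemma coefL1 s e : coefL s e 1 = (e == 0)%:R.
Proof.
have -> : 1 = lsum s [:: (1, 0)].
  by rewrite /lsum big_seq1 rmorph1 mono0 mulr1.
by rewrite coefL_lsum /lcoef big_mkcond big_seq1 eq_sym; case: eqP.
Qed.

Lemma laurentM s f g : laurent s f -> laurent s g -> laurent s (f * g).
Proof.
move=> [xs ->] Lg; rewrite /lsum mulr_suml; elim/big_rec: _ => [|x h _ Lh].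
  exact: laurent0.
by apply: laurentD => //; rewrite -mulrA; apply/laurentZ/laurent_mulmono.
Qed.

Lemma laurent_sum s (I : Type) (r : seq I) (G : I -> ratfun F) :
  (forall k, laurent s (G k)) -> laurent s (\sum_(k <- r) G k).
Proof.
move=> LG; elim/big_rec: _ => [|k f _ Lf]; first exact: laurent0.
exact: laurentD.
Qed.

Lemma coefL_sum s e (I : Type) (r : seq I) (G : I -> ratfun F) :
  (forall k, laurent s (G k)) ->
  coefL s e (\sum_(k <- r) G k) = \sum_(k <- r) coefL s e (G k).
Proof.
move=> LG; elim: r => [|k r IH]; last first.
  by rewrite !big_cons coefLD ?IH //; apply: laurent_sum.
rewrite !big_nil; have -> : 0 = lsum s [::] by rewrite /lsum big_nil.
by rewrite coefL_lsum /lcoef big_nil.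
Qed.

Lemma vx_mono s : vx s = mono s (1, 0, 0).
Proof. by rewrite /mono /= !expr0z !mulr1 expr1z. Qed.

Lemma vc_mono s : vc F = mono s (0, 1, 0).
Proof. by rewrite /mono /= !expr0z mulr1 mul1r expr1z. Qed.

Lemma vt_mono s : vt = mono s (0, 0, 1).
Proof. by rewrite /mono /= !expr0z !mul1r expr1z. Qed.

Lemma monoV s e : (mono s e)^-1 = mono s (- e).
Proof.
by apply: (mulfI (mono_neq0 s e)); rewrite -monoD subrr mono0 mulfV ?mono_neq0.
Qed.

Lemma laurent_mono s e : laurent s (mono s e).
Proof. by rewrite -[mono s e]mulr1; apply/laurent_mulmono/laurent1. Qed.

Lemma vx_negb s : vx (~~ s) = mono s (-1, 0, 0) * (vc F - vt).
Proof. by rewrite -(vx_mul s) (vx_mono s) mulrA -monoD mono0 mul1r. Qed.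

Lemma laurent_vct s f : laurent s f -> laurent s ((vc F - vt) * f).
Proof.
move=> Lf; rewrite mulrBl -mulN1r mulrA -(rmorphN1 (@cst F)) -mulrA.
rewrite (vc_mono s) (vt_mono s).
by apply: laurentD; [|apply: laurentZ]; apply: laurent_mulmono.
Qed.

Lemma expoB i j l i' j' l' :
  (i, j, l) - (i', j', l') = (i - i', j - j', l - l') :> expo.
Proof. by []. Qed.

Lemma coefL_vct s i j l f : laurent s f ->
  coefL s (i, j, l) ((vc F - vt) * f) =
  coefL s (i, j - 1, l) f - coefL s (i, j, l - 1) f.
Proof.
move=> Lf; rewrite mulrBl (vc_mono s) (vt_mono s) coefLB ?coefL_mono //;
  try exact: laurent_mulmono.
by rewrite !expoB !subr0.
Qed.

(** The variable left out of the coordinates is x^{-1} (c - t). *)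
Lemma V_laurent s : V F `<=` laurent s.
Proof.
apply: V_ind => [z|f g|f g|s'||| ].
- by rewrite -[cst z]mulr1; apply/laurentZ/laurent1.
- exact: laurentD.
- exact: laurentM.
- case: (eqVneq s' s) => [->|]; first by rewrite vx_mono; apply: laurent_mono.
  move=> /bool_neqE ->; rewrite vx_negb.
  apply/laurent_mulmono; rewrite -[_ - _]mulr1.
  exact/laurent_vct/laurent1.
- by rewrite (vc_mono s); apply: laurent_mono.
- by rewrite (vc_mono s) monoV; apply: laurent_mono.
- by rewrite (vt_mono s) monoV; apply: laurent_mono.
Qed.

Lemma coefL_bounded s f : laurent s f ->
  exists N : int, forall i j l, l < N -> coefL s (i, j, l) f = 0.
Proof.
move=> [xs ->]; have [N Npos] := expo_bound [seq x.2 | x <- xs].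
exists (- N%:Z) => i j l lN.
rewrite coefL_lsum /lcoef big_seq_cond big1 // => x.
case/andP => x_xs /eqP x2; have := Npos _ (map_f snd x_xs).
by rewrite x2 /nonneg /= => /and3P[_ _]; lia.
Qed.

(** * Cancelling c - t *)

(** The hypothesis says that the coefficients of f agree at (j, l) and at
    (j + 1, l - 1) for l < N.  Following this chain, the power of t drops
    below every power occurring in f. *)
Lemma vct_cancel s i (N : int) f : laurent s f ->
  (forall j l, l < N -> coefL s (i, j, l) ((vc F - vt) * f) = 0) ->
  forall j l, l < N -> coefL s (i, j, l) f = 0.
Proof.
move=> Lf cf0 j l lN; have [M lM] := coefL_bounded Lf.
have step (k : nat) : coefL s (i, j, l) f = coefL s (i, j + k%:Z, l - k%:Z) f.
  elim: k => [|k ->]; first by rewrite addr0 subr0.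
  have lkN : l - k%:Z < N by lia.
  have := cf0 (j + k.+1%:Z) _ lkN; rewrite coefL_vct // => /eqP.
  rewrite subr_eq0 => /eqP; congr (coefL s _ _ = coefL s _ _);
    by congr (_, _, _); lia.
by rewrite (step `|l - M|.+1%N) lM //; lia.
Qed.

Lemma vctX_cancel s i (N : int) n f : laurent s f ->
  (forall j l, l < N -> coefL s (i, j, l) ((vc F - vt) ^+ n * f) = 0) ->
  forall j l, l < N -> coefL s (i, j, l) f = 0.
Proof.
elim: n f => [|n IH] f Lf; first by rewrite mul1r.
rewrite exprSr => cf0; apply: vct_cancel => //.
apply: IH; first exact: laurent_vct.
by move=> j l lN; rewrite mulrA; apply: cf0.
Qed.

(** * Decompositions and the residue *)

(** The index of x^n c^m t^l; for n = 0 both choices of x give the same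
    monomial, which is listed in the family e only. *)
Definition idx s (n : nat) m l : basis_idx :=
  if s then inl (n, m, l) else
  if n is n'.+1 then inr (n', m, l) else inl (0%N, m, l).

Lemma basis_vec_idx s (n : nat) m l :
  basis_vec F (idx s n m l) = mono s (n%:Z, m, l).
Proof. by case: s n => [] [|n] //; rewrite /mono /= !expr0z. Qed.

Lemma idxP (k : basis_idx) : exists s n m l, k = idx s n m l.
Proof.
case: k => -[[n m] l]; first by exists true, n, m, l.
by exists false, n.+1, m, l.
Qed.

Lemma idx_inj s (n n' : nat) m m' l l' :
  idx s n m l = idx s n' m' l' -> (n%:Z, m, l) = (n'%:Z, m', l') :> expo.
Proof. by case: s n n' => [] [|n] [|n'] //=; congruence. Qed.

Lemma mono_negb s (n : nat) m l :
  mono (~~ s) (n%:Z, m, l) = mono s (- n%:Z, m, l) * (vc F - vt) ^+ n.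
Proof.
elim: n => [|n IH]; first by rewrite mulr1 /mono /= !expr0z.
have -> : (n.+1%:Z, m, l) = (1, 0, 0) + (n%:Z, m, l) :> expo.
  by congr (_, _, _); rewrite ?add0r //=; lia.
have -> : (- n.+1%:Z, m, l) = (-1, 0, 0) + (- n%:Z, m, l) :> expo.
  by congr (_, _, _); rewrite ?add0r //=; lia.
by rewrite !monoD IH -vx_mono vx_negb exprS mulrACA.
Qed.

Lemma coefL_vctX1 s i j l n : i != 0 ->
  coefL s (i, j, l) ((vc F - vt) ^+ n) = 0.
Proof.
move=> i0; elim: n j l => [|n IH] j l.
  by rewrite coefL1; case: eqP => // -[/eqP]; rewrite (negbTE i0).
rewrite exprS coefL_vct ?IH ?subr0 //.
by elim: (n) => [|k Lk]; [exact: laurent1 | rewrite exprS; exact: laurent_vct].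
Qed.

Lemma laurent_vctX s n f : laurent s f -> laurent s ((vc F - vt) ^+ n * f).
Proof.
move=> Lf; elim: n => [|n IH]; first by rewrite mul1r.
by rewrite exprS -mulrA; apply: laurent_vct.
Qed.

(** Distinct basis vectors do not interfere: in the coordinates with x, a vector
    involving the other variable to a power n' > 0 has degree -n' < 0 in x. *)
Lemma coefL_basis s s' (n n' : nat) m m' l l' :
  coefL s (n%:Z, m, l) (mono s' (n'%:Z, m', l'))
    = (idx s' n' m' l' == idx s n m l)%:R.
Proof.
have same : coefL s (n%:Z, m, l) (mono s (n'%:Z, m', l'))
    = (idx s n' m' l' == idx s n m l)%:R.
  rewrite -[mono _ _]mulr1 coefL_mono ?coefL1 ?subr_eq0; last exact: laurent1.
  by congr (nat_of_bool _)%:R; apply/eqP/eqP => [[-> -> ->]|/idx_inj ->].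
have [-> //|s's] := eqVneq s' s.
rewrite (bool_neqE s's).
case: n' same => [|n'] same.
  have -> : idx (~~ s) 0 m' l' = idx s 0 m' l' by case: (s).
  by rewrite -same /mono /= !expr0z.
have -> : idx (~~ s) n'.+1 m' l' == idx s n m l = false.
  by apply/eqP; case: (s) (n) => [] [].
rewrite mono_negb coefL_mono; first by rewrite expoB coefL_vctX1 //; lia.
by rewrite -[_ ^+ _]mulr1; apply/laurent_vctX/laurent1.
Qed.

Local Notation decomp := {fsfun basis_idx -> F with 0}.

Lemma V_mono s (n : nat) m l : V F (mono s (n%:Z, m, l)).
Proof.
apply: gen_algM; last first.
  by apply: gen_algXz; [exact: (Vplus_sub_V Vplus_vt) | exact: V_vtV].
apply: gen_algM; first by apply: gen_algX; apply: V_vx.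
by apply: gen_algXz; [exact: V_vc | exact: V_vcV].
Qed.

Lemma Vplus_mono s (n : nat) m (l : nat) : Vplus F (mono s (n%:Z, m, l%:Z)).
Proof.
apply: gen_algM; last by apply: gen_algX; exact: Vplus_vt.
apply: gen_algM; first by apply: gen_algX; apply: Vplus_vx.
by apply: gen_algXz; [exact: Vplus_vc | exact: Vplus_vcV].
Qed.

(** Decompositions are unique because their coefficients are Laurent
    coefficients of f. *)
Lemma coefL_decomposition (d : decomp) f s (n : nat) m l :
  decomposition d f -> coefL s (n%:Z, m, l) f = d (idx s n m l).
Proof.
move=> ->; have Lb (k : basis_idx) : laurent s (basis_vec F k).
  have [s' [n' [m' [l' ->]]]] := idxP k; rewrite basis_vec_idx.
  exact/V_laurent/V_mono.
rewrite coefL_sum => [|k]; last exact: laurentZ.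
have lcb (k : basis_idx) :
    coefL s (n%:Z, m, l) (basis_vec F k) = (k == idx s n m l)%:R.
  by have [s' [n' [m' [l' ->]]]] := idxP k; rewrite basis_vec_idx coefL_basis.
rewrite (eq_bigr (fun k => if k == idx s n m l then d k else 0)); last first.
  by move=> k _; rewrite coefLZ // lcb; case: eqP; rewrite ?mulr1 ?mulr0.
set k0 := idx s n m l; have [k0_d|k0_d] := boolP (k0 \in finsupp d).
  rewrite (bigD1_seq k0) ?fset_uniq //= eqxx big1 ?addr0 // => k /negbTE.
  by move=> ->.
rewrite (fsfun_dflt k0_d) big_seq big1 // => k k_d.
by case: eqP k_d => // ->; rewrite (negbTE k0_d).
Qed.

Definition spanned f := exists d : decomp, decomposition d f.

(** Enlarging the index set is what allows two decompositions to be added. *)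
Lemma decomposition_wide (d : decomp) (S : {fset basis_idx}) :
  (finsupp d `<=` S)%fset ->
  \sum_(k <- finsupp d) cst (d k) * basis_vec F k
    = \sum_(k <- S) cst (d k) * basis_vec F k.
Proof.
move=> dS; apply: big_fset_incl => // k _ k_d.
by rewrite fsfun_dflt // rmorph0 mul0r.
Qed.

Lemma spannedD f g : spanned f -> spanned g -> spanned (f + g).
Proof.
move=> [d df] [d' d'g]; pose S := (finsupp d `|` finsupp d')%fset.
pose d'' : decomp := [fsfun k in S => d k + d' k | 0].
exists d''; rewrite /decomposition (@decomposition_wide d'' S); last first.
  apply/fsubsetP => k; rewrite mem_finsupp fsfun_fun.
  by case: ifP; rewrite ?eqxx.
rewrite df d'g !(@decomposition_wide _ S) ?fsubsetUl ?fsubsetUr // -big_split.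
apply: eq_big_seq => k kS; by rewrite fsfun_fun kS /= -mulrDl -rmorphD.
Qed.

Lemma spanned_basis z k : spanned (cst z * basis_vec F k).
Proof.
pose d : decomp := [fsfun k' in [fset k]%fset => z | 0].
exists d; rewrite /decomposition (@decomposition_wide d [fset k]%fset).
  by rewrite big_seq_fset1 fsfun_fun inE eqxx.
apply/fsubsetP => k'; rewrite mem_finsupp fsfun_fun.
by case: ifP; rewrite ?eqxx.
Qed.

Lemma spanned0 : spanned 0.
Proof. by have := spanned_basis 0 (phi_idx); rewrite rmorph0 mul0r. Qed.

Lemma spanned_mono s (n : nat) m l : spanned (mono s (n%:Z, m, l)).
Proof.
have := spanned_basis 1 (idx s n m l).
by rewrite basis_vec_idx rmorph1 mul1r.
Qed.

Lemma spannedZ z f : spanned f -> spanned (cst z * f).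
Proof.
move=> [d ->]; rewrite mulr_sumr; elim/big_rec: _ => [|k g _ Sg].
  exact: spanned0.
by apply: spannedD => //; rewrite mulrA -rmorphM; apply: spanned_basis.
Qed.

Lemma spannedM f :
  (forall s (n : nat) m l, spanned (f * mono s (n%:Z, m, l))) ->
  forall g, spanned g -> spanned (f * g).
Proof.
move=> fS _ [d ->]; rewrite mulr_sumr; elim/big_rec: _ => [|k h _ Sh].
  exact: spanned0.
apply: spannedD => //; rewrite mulrCA; apply: spannedZ.
by have [s [n [m [l ->]]]] := idxP k; rewrite basis_vec_idx.
Qed.

(** Multiplication by x raises the exponent of x, or else uses ab = c - t to
    lower that of the other variable. *)
Lemma spanned_vx s s' (n : nat) m l :
  spanned (vx s * mono s' (n%:Z, m, l)).
Proof.
have same k m' l' : spanned (vx s * mono s (k%:Z, m', l')).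
  rewrite vx_mono -monoD (_ : _ + _ = (k.+1%:Z, m', l')).
    exact: spanned_mono.
  by congr (_, _, _); rewrite ?add0r //=; lia.
have [-> //|s's] := eqVneq s' s.
rewrite (bool_neqE s's).
case: n => [|n]; first by have := same 0%N m l; rewrite /mono /= !expr0z.
have -> : (n.+1%:Z, m, l) = (1, 0, 0) + (n%:Z, m, l) :> expo.
  by congr (_, _, _); rewrite ?add0r //=; lia.
rewrite monoD -vx_mono mulrA vx_mul mulrBl.
rewrite (vc_mono (~~ s)) (vt_mono (~~ s)) -!monoD.
rewrite -mulN1r -(rmorphN1 (@cst F)).
apply: spannedD; last apply: spannedZ; exact: spanned_mono.
Qed.

(** The span of the basis vectors is stable under multiplication by the
    generators of V, hence by V, and it contains 1. *)
Lemma V_spanned : V F `<=` spanned.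
Proof.
suff VS f : V F f -> forall g, spanned g -> spanned (f * g).
  move=> f /VS /(_ _ (spanned_mono true 0 0 0)).
  by rewrite (_ : mono _ _ = 1) ?mulr1 //; exact: mono0.
elim/V_ind: f / => [z|f g Sf Sg h Sh|f g Sf Sg h Sh|s|||].
- exact: spannedZ.
- by rewrite mulrDl; apply: spannedD; [apply: Sf | apply: Sg].
- by rewrite -mulrA; apply/Sf/Sg.
- by apply: spannedM => s' n m l; apply: spanned_vx.
- apply: spannedM => s n m l; rewrite (vc_mono s) -monoD.
  exact: spanned_mono.
- apply: spannedM => s n m l; rewrite (vc_mono s) monoV -monoD.
  exact: spanned_mono.
- apply: spannedM => s n m l; rewrite (vt_mono s) monoV -monoD.
  exact: spanned_mono.
Qed.

Lemma Res_coefL s f : V F f -> Res f = coefL s (0, -1, -1) f.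
Proof.
move=> Vf; have [d df] := V_spanned Vf.
have phiE (d' : decomp) : decomposition d' f ->
    d' phi_idx = coefL s (0, -1, -1) f.
  by move=> d'f; rewrite (coefL_decomposition s 0 (-1) (-1) d'f); case: (s).
by apply: xget_unique => [|_ [d' /phiE <- ->]] //; exists d; rewrite ?phiE.
Qed.

(** * Orthogonality *)

(** Pairing f with y^n c^m t^l, where y is the other variable, gives a
    coefficient of x^n in (c - t)^n f; it remains to cancel (c - t)^n. *)
Lemma orthogonal_coefL f (N : int) : V F f ->
  (forall s (n : nat) m l, N <= l -> pairing f (mono s (n%:Z, m, l)) = 0) ->
  forall s (n : nat) m l, l < - N -> coefL s (n%:Z, m, l) f = 0.
Proof.
move=> Vf f0 s n m l lN; have Lf := V_laurent s Vf.
apply: (vctX_cancel (N := - N) (n := n)) => // m' l' l'N.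
have := f0 (~~ s) n (-1 - m') (-1 - l'); rewrite /pairing.
rewrite (Res_coefL s); last first.
  by apply: gen_algM => //; apply: V_mono.
rewrite mono_negb mulrC -mulrA coefL_mono; last exact: laurent_vctX.
rewrite !expoB => <-; last by lia.
by congr (coefL _ _ _); congr (_, _, _); lia.
Qed.

Lemma V_coefL_eq0 f : V F f ->
  (forall s (n : nat) m l, coefL s (n%:Z, m, l) f = 0) -> f = 0.
Proof.
move=> Vf f0; have [d df] := V_spanned Vf; rewrite df big1 // => k _.
have [s [n [m [l ->]]]] := idxP k.
by rewrite -(coefL_decomposition s n m l df) f0 rmorph0 mul0r.
Qed.

Lemma V_coefL_Vplus f : V F f ->
  (forall s (n : nat) m l, l < 0 -> coefL s (n%:Z, m, l) f = 0) -> Vplus F f.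
Proof.
move=> Vf f0; have [d df] := V_spanned Vf; rewrite df; apply: gen_alg_sum => k.
have [s [n [m [l ->]]]] := idxP k.
rewrite -(coefL_decomposition s n m l df) basis_vec_idx.
case: l => l; last first.
  by rewrite f0 // rmorph0 mul0r -(rmorph0 (@cst F)); apply: Vplus_cst.
by apply: gen_algM; [exact: Vplus_cst | exact: Vplus_mono].
Qed.

Definition t_integral s f := forall i j l, l < 0 -> coefL s (i, j, l) f = 0.

Lemma t_integral_mono s i j (l : nat) f : laurent s f -> t_integral s f ->
  t_integral s (mono s (i, j, l%:Z) * f).
Proof.
move=> Lf f0 i' j' l' l'0; rewrite coefL_mono // expoB; apply: f0; lia.
Qed.

(** Functions without negative powers of t are stable under multiplication by
    each generator of V_+, in particular by x^{-1} (c - t). *)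
Lemma Vplus_t_integral s f : Vplus F f -> t_integral s f.
Proof.
suff Vt : Vplus F f ->
    forall g, laurent s g -> t_integral s g -> t_integral s (f * g).
  move=> Vf; rewrite -[f]mulr1; apply: Vt => //; first exact: laurent1.
  by move=> i j l l0; rewrite coefL1; case: eqP => // -[_ _ l1]; lia.
suff: Vplus F f -> laurent s f /\
    forall g, laurent s g -> t_integral s g -> t_integral s (f * g).
  by move=> VK /VK[].
elim/Vplus_ind: f / => [z|f g [Lf tf] [Lg tg]|f g [Lf tf] [Lg tg]|s'||].
- split=> [|g Lg tg i j l l0]; first exact/V_laurent/Vplus_sub_V/Vplus_cst.
  by rewrite coefLZ // tg ?mulr0.
- split=> [|h Lh th i j l l0]; first exact: laurentD.
  by rewrite mulrDl coefLD ?tf ?tg ?addr0 //; apply: laurentM.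
- split=> [|h Lh th]; first exact: laurentM.
  by rewrite -mulrA; apply: tf; [apply: laurentM | apply: tg].
- split=> [|g Lg tg]; first exact/V_laurent/V_vx.
  have [->|s's] := eqVneq s' s.
    by rewrite vx_mono; apply: t_integral_mono.
  rewrite (bool_neqE s's).
  rewrite vx_negb -mulrA; apply: t_integral_mono; first exact: laurent_vct.
  by move=> i j l l0; rewrite coefL_vct // !tg ?subr0 //; lia.
- split=> [|g Lg tg]; first exact/V_laurent/V_vc.
  by rewrite (vc_mono s); apply: t_integral_mono.
- split=> [|g Lg tg]; first exact/V_laurent/V_vcV.
  by rewrite (vc_mono s) monoV; apply: t_integral_mono.
Qed.

Lemma pairingC f g : pairing f g = pairing g f.
Proof. by rewrite /pairing mulrC. Qed.

Lemma pairing_nondegenerate : nondegenerate_on (@pairing F) (V F).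
Proof.
have nd f : V F f -> (forall g, V F g -> pairing f g = 0) -> f = 0.
  move=> Vf f0; apply: V_coefL_eq0 => // s n m l.
  (* The largest threshold N with l < - N. *)
  apply: (@orthogonal_coefL f (- l - 1)) => //; last by lia.
  by move=> *; apply/f0/V_mono.
by split=> // g Vg g0; apply: nd => // f Vf; rewrite pairingC; apply: g0.
Qed.

Lemma Vplus_isotropic : isotropic_subspace (@pairing F) (V F) (Vplus F).
Proof.
split; first exact: Vplus_sub_V.
- split=> [|z f g Vf Vg].
    by rewrite -(rmorph0 (@cst F)); apply: Vplus_cst.
  by apply: gen_algD => //; apply: gen_algM => //; apply: Vplus_cst.
move=> f g Vf Vg; have Vfg := gen_algM Vf Vg.
rewrite /pairing (Res_coefL true (Vplus_sub_V Vfg)).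
by rewrite (Vplus_t_integral true Vfg).
Qed.

Lemma Vplus_maximal_isotropic :
  maximal_isotropic (@pairing F) (V F) (Vplus F).
Proof.
split; first exact: Vplus_isotropic.
move=> W [WV _ W0] VW; apply/seteqP; split=> // f Wf.
apply: V_coefL_Vplus => [|s n m l l0]; first exact: WV.
apply: (@orthogonal_coefL f 0) => //; first exact: WV.
by move=> s' n' m' [] // l' _; apply: W0 => //; apply/VW/Vplus_mono.
Qed.

Lemma Vplus_nplus (X : 'M[F]_3) f : Vplus F f -> Vplus F (nplus_act X f).
Proof.
move=> /Vplus_derivations[V1 V2 V3].
by do ?[apply: gen_algD]; apply: gen_algM => //; apply: Vplus_cst.
Qed.

End RegularFunctionsTheory.

Theorem proposition5p4 (R : realType) :
  (* (i) *)
  (Vplus R[i] 1 /\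
   forall f g, Vplus R[i] f -> Vplus R[i] g -> Vplus R[i] (f * g)) /\
  (* (ii) *)
  ((forall (X : 'M[R[i]]_3) f,
      nplus R[i] X -> Vplus R[i] f -> Vplus R[i] (nplus_act X f)) /\
   (forall f, Vplus R[i] f ->
      [/\ Vplus R[i] (d1 f), Vplus R[i] (d2 f) & Vplus R[i] (d3 f)])) /\
  (* (iii) *)
  nondegenerate_on (@pairing R[i]) (V R[i]) /\
  (* (iv) *)
  maximal_isotropic (@pairing R[i]) (V R[i]) (Vplus R[i]).
Proof.
split; last split; last split.
- split; last by move=> f g; apply: gen_algM.
  by rewrite -(rmorph1 (@cst R[i])); apply: Vplus_cst.
- split=> [X f _|f]; [exact: Vplus_nplus | exact: Vplus_derivations].
- exact: pairing_nondegenerate.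
- exact: Vplus_maximal_isotropic.
Qed.
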